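(* Let $\delta\in(0,\varepsilon]$ and $\beta\in(0,1]$. Suppose that $\theta^{(1)},\dots,\theta^{(N)}$ are independent and identically distributed realizations drawn from $\mathbb{P}$, that $\mathcal{D}^{(1)},\dots,\mathcal{D}^{(K)}$ is a (known) partition of $\mathcal{D}\supseteq\Theta$ in the sense described in the context, and that $$N\ \geq\ \frac{K\log 2+\log\frac1\beta}{2\delta^2}.$$ Then $$\mathbb{P}^N\left(\mathcal{F}_{\mathrm{PP}_{\varepsilon-\delta}}\ \subseteq\ \mathcal{F}_{\mathrm{CP}_{\varepsilon}}\right)\ \geq\ 1-\beta,$$ i.e., any feasible solution of $\mathrm{PP}_{\varepsilon-\delta}$ is feasible for $\mathrm{CP}_\varepsilon$ with probability at least $1-\beta$.
   Context: Setting. $\mathcal{X}\subset\mathbb{R}^{n_x}$, $\Theta\subset\mathbb{R}^{n_\theta}$, and $(\Theta,\mathfrak{B}(\Theta),\mathbb{P})$ is a probability space (Borel $\sigma$-algebra); $\theta$ is a random variable with law $\mathbb{P}$, and $\Pr$, $\mathbb{E}$ are taken with respect to $\theta\sim\mathbb{P}$. $\mathbb{P}^N$ is the product measure, i.e. the law of the $N$ i.i.d. samples $(\theta^{(1)},\dots,\theta^{(N)})$. $\varepsilon\in[0,1)$ is the risk parameter, and $N,K,Z$ are positive integers. Partition. $\mathcal{D}\subset\mathbb{R}^{n_\theta}$ satisfies $\Theta\subseteq\mathcal{D}$, and $\mathcal{D}^{(1)},\dots,\mathcal{D}^{(K)}\subseteq\mathcal{D}$ are non-empty sets with $\bigcup_{j=1}^K\mathcal{D}^{(j)}=\mathcal{D}$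 and $\Pr(\theta\in\mathcal{D}^{(i)}\cap\mathcal{D}^{(j)})=0$ for $i\neq j$. The functions below are defined on $\mathcal{X}\times\mathcal{D}$. Constraint function. $g(x,\theta)=\min_{h\in\{1,\dots,Z\}}g_h(x,\theta)$, with $g_h:\mathcal{X}\times\mathcal{D}\to\mathbb{R}$ measurable. Chance-constrained problem $\mathrm{CP}_\varepsilon$: minimize $\mathbb{E}[J(x,\theta)]$ over $x\in\mathcal{X}$ subject to $\Pr(g(x,\theta)\leq 0)\geq 1-\varepsilon$, where $J\geq 0$ is measurable. Its feasible set is $$\mathcal{F}_{\mathrm{CP}_\varepsilon}=\{x\in\mathcal{X}:\Pr(g(x,\theta)\leq 0)\geq 1-\varepsilon\}.$$ Empirical probabilities. $\mathcal{C}^{(j)}=\{i\in\{1,\dots,N\}:\theta^{(i)}\in\mathcal{D}^{(j)}\}$ and $\hat p^{(j)}=|\mathcal{C}^{(j)}|/N$ for $j=1,\dots,K$. Partition-based problem $\mathrm{PP}_{\alpha}$ (for a risk level $\alpha$): minimize $\sum_{j=1}^K\hat p^{(j)}J(x,\hat\theta^{(j)})$, where $\hat\theta^{(j)}$ is a chosen representative element for $\mathcal{D}^{(j)}$, over the feasible set $$\mathcal{F}_{\mathrm{PP}_\alpha}=\Big\{x\in\mathcal{X}:\ \sum_{j=1}^K\hat p^{(j)}\,\mathbf{1}_{[\bigvee_{h=1}^Z(g_h(x,\theta)\leq 0\ \forall\theta\in\mathcal{D}^{(j)})]}\geq 1-\alpha\Big\},$$ where $\mathbf{1}_{[X]}$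 equals 1 if the logical statement $X$ holds and 0 otherwise; thus the indicator equals 1 iff there is a single $h$ with $g_h(x,\theta)\le 0$ for all $\theta\in\mathcal{D}^{(j)}$. *)

(* Defs.v *)
From HB Require Import structures.
From mathcomp Require Import all_boot all_order all_algebra.
From mathcomp Require Import all_classical all_reals all_analysis.

Set Implicit Arguments.
Unset Strict Implicit.
Unset Printing Implicit Defensive.

Import Order.TTheory GRing.Theory Num.Theory.
Import numFieldNormedType.Exports.

Local Open Scope classical_set_scope.
Local Open Scope ring_scope.

(* The subset [A] as a topological space of its own.  Measurable types must be
   pointed, hence the non-emptiness argument; it costs nothing for a set that
   carries a probability measure. *)
Definition subspace_of (T : topologicalType) (A : set T) (hA : A !=set0) : Type :=
  set_type A.

Section SubspaceOf.
Variables (T : topologicalType) (A : set T) (hA : A !=set0).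

HB.instance Definition _ := Topological.copy (subspace_of hA) (set_type A).

Definition subspace_point : subspace_of hA :=
  let: exist x Ax := cid hA in exist _ x (mem_set Ax).

HB.instance Definition _ := isPointed.Build (subspace_of hA) subspace_point.

End SubspaceOf.

(* A topological space equipped with its Borel sigma-algebra. *)
Notation borel T := (g_sigma_algebraType (@open T)).

Definition to_ambient (T : topologicalType) (A : set T) (hA : A !=set0)
  (t : borel (subspace_of hA)) : T := sval t.

(* Measurability of the restriction [A -> R] of [f] for the Borel sigma-algebra
   of the subspace [A]; unlike [measurable_fun A f], it is not vacuous when [A]
   is not a Borel set. *)
Definition borel_fun_on (R : realType) (T : topologicalType) (A : set T)
  (f : T -> R) : Prop :=
  forall Y : set R, measurable Y ->
    <<s (@open (set_type A)) >> ((fun t : set_type A => f (sval t)) @^-1` Y).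

Section ProductLaw.
Context {d : measure_display} {T : measurableType d} {R : realType}.

Definition prod_law {d' : measure_display} {T' : measurableType d'}
  (P : probability T R) (Q : probability T' R) : set (T * T') -> \bar R :=
  (P \x Q)%E.

Section ProdLawProbability.
Context {d' : measure_display} {T' : measurableType d'}.
Variables (P : probability T R) (Q : probability T' R).

HB.instance Definition _ := Measure.on (prod_law P Q).

Let prod_lawT : prod_law P Q setT = 1%E.
Proof.
rewrite -setXTT /prod_law product_measure1E// -[RHS]mule1.
by congr (_ * _)%E; exact: probability_setT.
Qed.

HB.instance Definition _ :=
  Measure_isProbability.Build _ _ _ (prod_law P Q) prod_lawT.

End ProdLawProbability.

Definition cons_pair (n : nat) (p : T * n.-tuple T) : n.+1.-tuple T :=
  [the n.+1.-tuple T of p.1 :: p.2].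

Lemma measurable_cons_pair n : measurable_fun setT (@cons_pair n).
Proof. exact: measurable_cons. Qed.

HB.instance Definition _ n :=
  isMeasurableFun.Build _ _ _ _ (@cons_pair n) (@measurable_cons_pair n).

(* The n-fold product measure of [P], by recursion on [n]; [iid_law_rect] is
   its characterization on measurable boxes. *)
Fixpoint iid_law (P : probability T R) (n : nat) : probability (n.-tuple T) R :=
  if n is m.+1 then distribution (prod_law P (iid_law P m)) (@cons_pair m)
  else dirac [tuple].

Lemma iid_law_rect (P : probability T R) (n : nat) (A : 'I_n -> set T) :
  (forall i, measurable (A i)) ->
  iid_law P n [set s | forall i, A i (tnth s i)] = (\prod_(i < n) P (A i))%E.
Proof.
elim: n A => [|n IHn] A mA.
  by rewrite big_ord0 /= diracE mem_set// => -[].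
rewrite big_ord_recl -IHn//= /distribution /pushforward.
rewrite /prod_law -product_measure1E//; last first.
  rewrite (_ : mkset _ =
      \bigcap_(i in [set: 'I_n]) ((@tnth n T)^~ i @^-1` A (lift ord0 i))).
    apply: fin_bigcap_measurable => // i _; rewrite -[X in measurable X]setTI.
    exact: measurable_tnth.
  by apply/seteqP; split=> [s As i _|s As i]; exact: As.
congr (product_measure1 _ _ _); apply/seteqP; split=> -[a s] /=.
  by move=> As; split=> [|i]; [exact: (As ord0)|have := As (lift ord0 i); rewrite /cons_pair tnthS].
move=> [A0 As] i; case: (unliftP ord0 i) => [j ->|->]; last exact: A0.
by rewrite tnthS; exact: As.
Qed.

End ProductLaw.

Record opt_problem (R : realType) (V : Type) := OptProblem {
  objective : V -> \bar R;
  feasible : set V }.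

Section Problems.
Variables (R : realType) (nx nt : nat).
Local Notation rVx := 'rV[R]_nx.
Local Notation rVt := 'rV[R]_nt.

(* [min_h g_h(x, t)]; the default value of the iterated minimum is one of the
   values over which the minimum is taken. *)
Definition min_constraint (Z : nat) (hZ : (0 < Z)%N) (g : 'I_Z -> rVx * rVt -> R)
  (z : rVx * rVt) : R :=
  \big[Num.min/g (Ordinal hZ) z]_(h < Z) g h z.

Variables (X : set rVx) (Theta : set rVt) (hTheta : Theta !=set0).
Local Notation sample := (borel (subspace_of hTheta)).

Definition CP (P : probability sample R) (J g : rVx * rVt -> R) (eps : R) :
    opt_problem R rVx :=
  {| objective := fun x => 'E_P[fun t : sample => J (x, to_ambient t)]%E;
     feasible := [set x | X x /\
       ((1 - eps)%:E <= P [set t : sample | (g (x, to_ambient t) <= 0)%R])%E] |}.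

Variables (N K Z : nat) (s : N.-tuple sample) (D : 'I_K -> set rVt).

Definition cell_indices (j : 'I_K) : {set 'I_N} :=
  [set i | `[< D j (to_ambient (tnth s i)) >]].

Definition phat (j : 'I_K) : R := #|cell_indices j|%:R / N%:R.

Definition PP (rep : 'I_K -> rVt) (J : rVx * rVt -> R)
    (g : 'I_Z -> rVx * rVt -> R) (alpha : R) : opt_problem R rVx :=
  {| objective := fun x => (\sum_(j < K) phat j * J (x, rep j))%:E;
     feasible := [set x | X x /\
       1 - alpha <= \sum_(j < K) phat j *
         `[< exists h : 'I_Z, forall t, D j t -> g h (x, t) <= 0 >]%:R] |}.

End Problems.

(* Main.v *)
(* A PP-feasible x is certified on a union A of cells whose empirical frequency is at least
   1 - eps + delta; if that frequency exceeds P A by less than delta, then P A > 1 - eps and x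
   is CP-feasible.  There are only 2^K unions of cells, so Hoeffding's inequality for the
   indicator of each of them and a union bound give a failure probability of at most
   2^K exp(-2 N delta^2) <= beta.  Overlaps of cells are avoided by almost every sample. *)
Require Import Defs.
From mathcomp Require Import all_boot all_order all_algebra.
From mathcomp Require Import all_classical all_reals all_analysis.
From mathcomp Require Import measurable_realfun ring lra.

Import Order.TTheory GRing.Theory Num.Theory.
Import numFieldNormedType.Exports.

Local Open Scope classical_set_scope.
Local Open Scope ring_scope.

(** * Moment generating function of a centred Bernoulli variable *)

Lemma ge0_derive_le (R : realType) (f df : R -> R) (x : R) : 0 <= x ->
  (forall y : R, 0 <= y -> is_derive y 1 f (df y)) ->
  (forall y, 0 <= y -> 0 <= df y) -> f 0 <= f x.
Proof.
move=> x0 fdf df0; rewrite -subr_ge0.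
have [||c] := @MVT_segment R f df 0 x x0.
- by move=> y; rewrite in_itv/= => /andP[/ltW y0 _]; exact: fdf.
- apply: derivable_within_continuous => y; rewrite in_itv/= => /andP[y0 _].
  by case: (fdf y y0).
by rewrite in_itv/= => /andP[c0 _] ->; rewrite subr0 mulr_ge0// df0.
Qed.

(* With w = 1 - p + p e^l, the claim is that w exp(- l p - l^2 / 8) is at most its value 1 at
   l = 0; it is nonincreasing because w' / w <= p + l / 4, which holds since both sides agree
   at 0 and (w' / w)' = (1 - p) p e^l / w^2 <= 1 / 4. *)
Lemma bernoulli_mgf_le (R : realType) (p l : R) : 0 <= p <= 1 -> 0 <= l ->
  p * expR (l * (1 - p)) + (1 - p) * expR (- (l * p)) <= expR (l ^+ 2 / 8).
Proof.
move=> /andP[p0 p1] l0.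
pose w (y : R) : R := 1 - p + p * expR y.
have w_gt0 y : 0 < w y.
  rewrite /w; have := expR_gt0 y; move: p0; rewrite le_eqVlt => /predU1P[<-|p0] ey.
    by rewrite mul0r subr0 addr0.
  by rewrite ltr_wpDl ?mulr_gt0 ?subr_ge0.
have w0 : w 0 = 1 by rewrite /w expR0; lra.
have wD (z : R) : is_derive z (1:R) w (p * expR z).
  by apply: is_derive_eq; rewrite add0r /GRing.scale/= mul1r.
have w'w (y : R) : 0 <= y -> p * expR y <= (p + y / 4) * w y.
  move=> y0; rewrite -ler_pdivrMr//.
  (* As w' / w = 1 - (1 - p) / w, this [f] is the gap p + z / 4 - w' / w plus one, and [f 0 = 1]. *)
  pose f (z : R) : R := p + z / 4 + (1 - p) / w z.
  pose df (z : R) : R := 4^-1 - (1 - p) * (p * expR z) / w z ^+ 2.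
  have fD (z : R) : 0 <= z -> is_derive z (1:R) f (df z).
    move=> z0; have wz0 := lt0r_neq0 (w_gt0 z).
    have ? := is_deriveV wz0 (wD z).
    by apply: is_derive_eq; rewrite /df /GRing.scale/=; field.
  have df0 (z : R) : 0 <= z -> 0 <= df z.
    move=> z0; rewrite /df subr_ge0 ler_pdivrMr ?exprn_gt0// -subr_ge0.
    (* AM-GM for the two summands [1 - p] and [p * expR z] of [w z]. *)
    have -> : 4^-1 * w z ^+ 2 - (1 - p) * (p * expR z) =
        (1 - p - p * expR z) ^+ 2 / 4 by rewrite /w; field.
    by rewrite mulr_ge0 ?sqr_ge0.
  have := ge0_derive_le _ _ _ _ y0 fD df0.
  rewrite /f w0.
  have -> : p * expR y / w y = 1 - (1 - p) / w y.
    by have := lt0r_neq0 (w_gt0 y); rewrite /w => wy0; field.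
  by lra.
pose u (z : R) : R := - (z * p) - z ^+ 2 / 8.
(* The sign makes [h] nondecreasing, as [ge0_derive_le] requires. *)
pose h (z : R) : R := - (w z * expR (u z)).
pose dh (z : R) : R := expR (u z) * ((p + z / 4) * w z - p * expR z).
have hD (z : R) : 0 <= z -> is_derive z (1:R) h (dh z).
  move=> z0.
  have uD : is_derive z (1:R) u (- p - z / 4).
    by apply: is_derive_eq; rewrite /GRing.scale/=; field.
  have ? := @is_derive1_comp _ expR u z _ _ (is_derive_expR (u z)) uD.
  by apply: is_derive_eq; rewrite /dh /GRing.scale/=; ring.
have dh0 (z : R) : 0 <= z -> 0 <= dh z.
  by move=> z0; rewrite mulr_ge0 ?expR_ge0// subr_ge0 w'w.
have := ge0_derive_le _ _ _ _ l0 hD dh0.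
have u0 : u 0 = 0 by rewrite /u; field.
rewrite /h lerN2 w0 u0 expR0 mulr1 => wu1.
have -> : expR (l ^+ 2 / 8) = expR (- (l * p)) * (expR (u l))^-1.
  by rewrite -expRN -expRD; congr expR; rewrite /u; ring.
rewrite ler_pdivlMr ?expR_gt0//.
rewrite (_ : _ + _ = w l * expR (- (l * p))); last first.
  by rewrite (_ : l * (1 - p) = l + - (l * p)); [rewrite expRD /w; ring|ring].
by rewrite mulrAC -[leRHS]mul1r ler_wpM2r ?expR_ge0.
Qed.

(** * Tail bounds and null events under the product law *)

Lemma measurable_excess d (T : measurableType d) (R : realType) (A : set T) (n : nat)
    (p a : R) : measurable A ->
  measurable [set s : n.-tuple T | a <= \sum_(i < n) (\1_A (tnth s i) - p)].
Proof.
move=> mA.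
have mf : measurable_fun setT
    (fun s : n.-tuple T => \sum_(i < n) (\1_A (tnth s i) - p)).
  apply: measurable_sum => i; apply: measurable_funB => //.
  apply: (@measurableT_comp _ _ _ _ _ _ (\1_A : T -> R)); first exact: measurable_indic.
  exact: measurable_tnth.
rewrite -[X in measurable X]setTI.
have := mf measurableT _ (measurable_itv `[a, +oo[); congr measurable.
by apply/seteqP; split=> s /=; rewrite in_itv/= andbT.
Qed.

(* Conditioning on the first sample splits the event of n.+1 samples into two boxes over events
   of n samples with shifted thresholds, so no integral of an exponential moment is needed. *)
Lemma iid_law_hoeffding d (T : measurableType d) (R : realType) (P : probability T R)
    (A : set T) (n : nat) (a l : R) : measurable A -> 0 <= l ->
  (iid_law P n [set s | (a <= \sum_(i < n) (\1_A (tnth s i) - fine (P A)))%R] <=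
   (expR (n%:R * (l ^+ 2 / 8) - l * a))%:E)%E.
Proof.
move=> mA l0; pose p := fine (P A).
have PA : P A = p%:E by rewrite fineK ?fin_num_measure.
have p01 : 0 <= p <= 1.
  by rewrite -!lee_fin -PA measure_ge0 probability_le1.
elim: n a => [|n IHn] a.
  (* With no samples the sum is zero: the event occurs only if [a <= 0], and then the bound is at
     least one. *)
  rewrite /= diracE; case: (boolP (_ \in _)) => [|_]; last first.
    by rewrite lee_fin expR_ge0.
  rewrite inE/= big_ord0 => a0; rewrite lee_fin.
  by rewrite mul0r add0r -expR0 ler_expR oppr_ge0 mulr_ge0_le0.
set E := (X in iid_law P n.+1 X).
pose En b := [set s : n.-tuple T | b <= \sum_(i < n) (\1_A (tnth s i) - p)].
have mEn b : measurable (En b) by exact: measurable_excess.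
have -> : iid_law P n.+1 E =
    prod_law P (iid_law P n) (A `*` En (a - (1 - p)) `|` ~` A `*` En (a + p)).
  rewrite /= /distribution /pushforward; congr (prod_law _ _ _).
  have EE x s : E (cons_pair (x, s)) =
      (a <= \1_A x - p + \sum_(i < n) (\1_A (tnth s i) - p)) :> Prop.
    rewrite /E/= big_ord_recl/= tnth0; congr (is_true (_ <= _ + _)).
    by apply: eq_bigr => i _; rewrite tnthS.
  apply/seteqP; split=> -[x s]; rewrite [preimage _ _ _]EE /En/= indicE.
    by case: (pselect (A x)) => Ax;
      rewrite ?(mem_set Ax) ?(memNset Ax)/= => aE; [left|right]; split=> //=; lra.
  by case=> -[/= Ax]; rewrite ?(mem_set Ax) ?(memNset Ax)/=; lra.
have mCA := measurableC mA.
rewrite measureU; [|exact: measurableX|exact: measurableX|]; last first.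
  by apply/seteqP; split=> // -[x s] /= [[Ax _] [/(_ Ax)]].
have XE B C : measurable B -> measurable C ->
    prod_law P (iid_law P n) (B `*` C) = (P B * iid_law P n C)%E.
  exact: product_measure1E.
rewrite [X in (X + _ <= _)%E](XE _ _ mA (mEn _)) [X in (_ + X <= _)%E](XE _ _ mCA (mEn _)).
rewrite probability_setC// PA -EFinB.
apply: (@le_trans _ _ (p%:E * (expR (n%:R * (l ^+ 2 / 8) - l * (a - (1 - p))))%:E +
   (1 - p)%:E * (expR (n%:R * (l ^+ 2 / 8) - l * (a + p)))%:E)%E).
  by apply: leeD; apply: lee_wpmul2l; rewrite ?lee_fin ?IHn//; case/andP: p01 => //; lra.
rewrite -!EFinM -EFinD lee_fin.
(* Once [expR c] is factored out of both boxes, the Bernoulli moment bound remains. *)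
set c := n%:R * (l ^+ 2 / 8) - l * a.
have -> : n%:R * (l ^+ 2 / 8) - l * (a - (1 - p)) = c + l * (1 - p) by rewrite /c; ring.
have -> : n%:R * (l ^+ 2 / 8) - l * (a + p) = c + - (l * p) by rewrite /c; ring.
have -> : n.+1%:R * (l ^+ 2 / 8) - l * a = c + l ^+ 2 / 8.
  by rewrite /c -natr1; ring.
rewrite !(expRD c) !(mulrCA _ (expR c)) -mulrDr ler_wpM2l ?expR_ge0//.
exact: bernoulli_mgf_le.
Qed.

(** The complement is a box whose sides all have probability one. *)
Lemma iid_law_negligible d (T : measurableType d) (R : realType) (P : probability T R)
    (B : set T) (n : nat) : measurable B -> P B = 0%E ->
  measurable [set s : n.-tuple T | exists i, B (tnth s i)] /\
  iid_law P n [set s | exists i, B (tnth s i)] = 0%E.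
Proof.
move=> mB PB; set Bs := [set s | _].
have mBs : measurable Bs.
  rewrite (_ : Bs = \bigcup_(i in [set: 'I_n]) ((fun s : n.-tuple T => tnth s i) @^-1` B)).
    apply: fin_bigcup_measurable => // i _; rewrite -[X in measurable X]setTI.
    exact: measurable_tnth.
  by apply/seteqP; split=> [s [i ?]|s [i _ ?]]; exists i.
split=> //; rewrite -[Bs]setCK probability_setC; last exact: measurableC.
have -> : ~` Bs = [set s | forall i, (~` B) (tnth s i)].
  by apply/seteqP; split=> s /= h; [move=> i Bi; apply: h; exists i|case=> i; exact: h].
rewrite (iid_law_rect P (A := fun=> ~` B)) => [|i]; last exact: measurableC.
by rewrite big1 ?subee// => i _; rewrite probability_setC// PB sube0.
Qed.

(** * Measurability of the events involved *)

(** [E] is a finite union of fibres of [F]. This handles an event that quantifies over uncountably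
    many decisions [x]. *)
Lemma measurable_finite_factor d (T : measurableType d) (C : finType) (F : T -> C)
    (E : set T) : (forall c, measurable (F @^-1` [set c])) ->
  (forall s s', F s = F s' -> E s -> E s') -> measurable E.
Proof.
move=> mF FE; rewrite (_ : E = \bigcup_(c in F @` E) (F @^-1` [set c])).
  exact: fin_bigcup_measurable.
apply/seteqP; split=> [s Es|s [_ [s' Es' <-]] /esym]; first by exists (F s) => //; exists s.
by move/FE; exact.
Qed.

Lemma borel_preimage (U V : topologicalType) (f : U -> V) (B : set V) :
  continuous f -> <<s @open V >> B -> <<s @open U >> (f @^-1` B).
Proof.
move=> /continuousP cf.
apply: (smallest_sub (X := fun B => <<s @open U >> (f @^-1` B))) => [|A oA]; last first.
  by apply: sub_sigma_algebra; exact: cf.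
have [s0 sC sU] := smallest_sigma_algebra [set: U] (@open U).
split=> [|A|A mA].
- by rewrite preimage_set0.
- by rewrite !setTD preimage_setC -setTD; exact: sC.
- by rewrite preimage_bigcup; exact: sU.
Qed.

(** The slice map sending t to (x, t) is continuous between the subspaces, so Borel sets pull back
    even if [Theta] or [Dom] is not Borel in the ambient space. *)
Lemma measurable_section_le0 (R : realType) (T1 T2 : topologicalType) (X : set T1)
    (Dom Theta : set T2) (hTheta : Theta !=set0) (f : T1 * T2 -> R) (x : T1) :
  X x -> Theta `<=` Dom -> borel_fun_on (X `*` Dom) f ->
  measurable [set t : borel (subspace_of hTheta) | f (x, to_ambient t) <= 0].
Proof.
move=> Xx sub mf.
have XD (t : set_type Theta) : (x, sval t) \in X `*` Dom.
  by rewrite inE; split=> //=; apply: sub; exact: set_mem (valP t).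
pose sec (t : set_type Theta) : set_type (X `*` Dom) := exist _ (x, sval t) (XD t).
have csec : continuous sec.
  apply/continuousP => _ [W oW <-].
  exists ((fun y => (x, y)) @^-1` W) => //.
  apply: open_comp => // y _.
  exact: cvg_pair (cvg_cst _) cvg_id.
exact: borel_preimage _ _ _ _ csec (mf _ (measurable_itv `]-oo, (0:R)])).
Qed.

(** * Union bound over the unions of cells *)

Lemma measure_le_sum d (T : measurableType d) (R : realType)
    (mu : {measure set T -> \bar R}) (I : finType) (A : set T) (F : I -> set T) :
  measurable A -> (forall i, measurable (F i)) -> (forall x, A x -> exists i, F i x) ->
  (mu A <= \sum_(i : I) mu (F i))%E.
Proof.
move=> mA mF AF; rewrite fsbig_seq ?index_enum_uniq//.
apply: content_sub_fsum => // x /AF[i Fix]; exists i => //=.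
by rewrite mem_index_enum.
Qed.

(** After exchanging the sums, an entry of [s] outside all overlaps is counted for at most one
    cell. *)
Lemma sum_cells_le_indic (T : Type) (R : realType) (K n : nat) (D : 'I_K -> set T)
    (S : {set 'I_K}) (s : n.-tuple T) :
  ~ (exists i, exists2 jk : 'I_K * 'I_K, jk.1 != jk.2 & (D jk.1 `&` D jk.2) (tnth s i)) ->
  \sum_(j in S) (#|[set i | `[< D j (tnth s i) >]]%SET|%:R : R) <=
  \sum_(i < n) \1_(\bigcup_(j in [set` S]) D j) (tnth s i).
Proof.
move=> sD.
under eq_bigr => j _.
  rewrite -sum1_card natr_sum (eq_bigl (fun i => `[< D j (tnth s i) >])); last first.
    by move=> i; rewrite finset.inE.
  rewrite big_mkcond/=; over.
rewrite exchange_big/=; apply: ler_sum => i _; rewrite indicE.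
have [|noS] := pselect ((\bigcup_(j in [set` S]) D j) (tnth s i)); last first.
  rewrite big1 ?ler0n// => j jS; case: asboolP => // Dj.
  by exfalso; apply: noS; exists j.
move=> Si; rewrite (mem_set Si); case: Si => j jS Dj.
rewrite (bigD1 j)//= big1 ?addr0 => [|k /andP[kS kj]].
  by case: asboolP.
by case: asboolP => // Dk; exfalso; apply: sD; exists i, (k, j).
Qed.

(** Each [S] costs one Hoeffding bound with the same [l], which is left free to be optimized
    later. *)
Lemma iid_law_cells d (T : measurableType d) (R : realType) (P : probability T R)
    (K n : nat) (D : 'I_K -> set T) (E : set (n.-tuple T)) (a l : R) :
  (forall j, measurable (D j)) ->
  (forall i j, i != j -> P (D i `&` D j) = 0%E) ->
  measurable E -> 0 <= l ->
  (forall s, E s -> exists S : {set 'I_K},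
    n%:R * fine (P (\bigcup_(j in [set` S]) D j)) + a <=
    \sum_(j in S) #|[set i | `[< D j (tnth s i) >]]%SET|%:R) ->
  (iid_law P n E <= (2 ^+ K * expR (n%:R * (l ^+ 2 / 8) - l * a))%:E)%E.
Proof.
move=> mD D0 mE l0 ES.
pose cov (S : {set 'I_K}) := \bigcup_(j in [set` S]) D j.
have mcov S : measurable (cov S) by exact: fin_bigcup_measurable.
pose offdiag := [set jk : 'I_K * 'I_K | jk.1 != jk.2].
pose ov := \bigcup_(jk in offdiag) (D jk.1 `&` D jk.2).
have mI jk : measurable (D jk.1 `&` D jk.2) by exact: measurableI.
have mov : measurable ov by exact: fin_bigcup_measurable.
have ov0 : P ov = 0%E.
  apply/eqP; rewrite eq_le measure_ge0 andbT.
  apply: (@le_trans _ _ (\sum_(jk \in offdiag) P (D jk.1 `&` D jk.2))%E).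
    by apply: content_sub_fsum => //; exact: finite_finset.
  by rewrite fsbig1// => jk /D0.
have [mO O0] := iid_law_negligible _ _ _ P ov n mov ov0.
pose bad (S : {set 'I_K}) : set (n.-tuple T) :=
  [set s | a <= \sum_(i < n) (\1_(cov S) (tnth s i) - fine (P (cov S)))].
have mbad S : measurable (bad S) by exact: measurable_excess.
set c := expR _.
(* The null event of hitting an overlap is joined to every [bad S]; this leaves each probability
   unchanged, and any [S], here the empty set, can absorb such samples. *)
apply: (@le_trans _ _
    (\sum_(S : {set 'I_K}) iid_law P n (bad S `|` [set s | exists i, ov (tnth s i)]))%E).
  apply: measure_le_sum => // [S|s Es]; first exact: measurableU.
  have [so|sov] := pselect (exists i, ov (tnth s i)); first by exists finset.set0; right.
  have [S leS] := ES s Es; exists S; left => /=.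
  rewrite /bad/= sumrB sumr_const card_ord lerBrDl -mulr_natl; apply: le_trans leS _.
  apply: sum_cells_le_indic => -[i [jk jkne Djk]]; apply: sov.
  by exists i, jk.
have -> : (2 ^+ K * c)%:E = (\sum_(S : {set 'I_K}) c%:E)%E.
  rewrite sumEFin sumr_const -natrX mulr_natl; congr (_ *+ _)%:E.
  by rewrite -[in RHS]cardsT -powersetT card_powerset cardsT card_ord.
apply: lee_sum => S _; rewrite measureU0//.
exact: iid_law_hoeffding.
Qed.

Theorem theorem1 (R : realType) (nx nt N K Z : nat)
    (hN : (0 < N)%N) (hK : (0 < K)%N) (hZ : (0 < Z)%N)
    (X : set 'rV[R]_nx)
    (Theta : set 'rV[R]_nt) (hTheta : Theta !=set0)
    (P : probability (borel (subspace_of hTheta)) R)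
    (Dom : set 'rV[R]_nt) (hDom : Theta `<=` Dom)
    (D : 'I_K -> set 'rV[R]_nt)
    (D_nonempty : forall j, D j !=set0)
    (D_cover : \bigcup_(j in [set: 'I_K]) D j = Dom)
    (D_meas : forall j,
       measurable [set t : borel (subspace_of hTheta) | D j (to_ambient t)])
    (D_null : forall i j, i != j ->
       P [set t | (D i `&` D j) (to_ambient t)] = 0%E)
    (g : 'I_Z -> 'rV[R]_nx * 'rV[R]_nt -> R)
    (g_meas : forall h, borel_fun_on (X `*` Dom) (g h))
    (J : 'rV[R]_nx * 'rV[R]_nt -> R)
    (J_meas : borel_fun_on (X `*` Dom) J)
    (J_ge0 : forall z, (X `*` Dom) z -> 0 <= J z)
    (rep : 'I_K -> 'rV[R]_nt) (rep_in : forall j, D j (rep j))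
    (eps delta beta : R)
    (heps : 0 <= eps < 1) (hdelta : 0 < delta <= eps) (hbeta : 0 < beta <= 1)
    (hNlb : (K%:R * ln 2 + ln (1 / beta)) / (2 * delta ^+ 2) <= N%:R) :
  ((1 - beta)%:E <=
     iid_law P N [set s | feasible (PP X s D rep J g (eps - delta))
                          `<=` feasible (CP X P J (min_constraint hZ g) eps)])%E.
Proof.
case/andP: hdelta => delta0 deltaeps; case/andP: hbeta => beta0 beta1.
set E := (X in iid_law P N X).
pose C j := [set t : borel (subspace_of hTheta) | D j (to_ambient t)].
have mE : measurable E.
  (* The samples enter [E] only through the index sets of the cells, which take finitely many
     values. *)
  pose F (s : N.-tuple (borel (subspace_of hTheta))) :=
    [ffun j : 'I_K => cell_indices s D j].
  apply: (measurable_finite_factor _ _ _ F) => [c|s s' FE].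
    rewrite (_ : F @^-1` [set c] = \bigcap_(ji in [set: 'I_K * 'I_N])
      ((fun s : N.-tuple (borel (subspace_of hTheta)) => tnth s ji.2) @^-1`
        (if ji.2 \in c ji.1 then C ji.1 else ~` C ji.1))).
      apply: fin_bigcap_measurable => [|[j i] _]; first exact: finite_finset.
      rewrite -[X in measurable X]setTI; apply: measurable_tnth => //.
      by case: ifP => _; [exact: D_meas|apply: measurableC; exact: D_meas].
    apply/seteqP; split=> [s <- [j i] _ /=|s Cs].
      by rewrite ffunE finset.inE; case: asboolP.
    apply/ffunP => j; rewrite ffunE; apply/finset.setP => i; rewrite finset.inE.
    have := Cs (j, i) I => /=; case: ifP => _ h; [exact: asboolT|exact: asboolF].
  have cE : cell_indices s D = cell_indices s' D.
    by apply/funext => j; have := congr1 (fun f : {ffun _ -> _} => f j) FE; rewrite !ffunE.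
  by rewrite /E /= /PP /phat cE.
have N0 : 0 < N%:R :> R by rewrite ltr0n.
have Nd : K%:R * ln 2 + ln (1 / beta) <= N%:R * (2 * delta ^+ 2).
  by rewrite -ler_pdivrMr// mulr_gt0// exprn_gt0.
have tail : (iid_law P N (~` E) <= beta%:E)%E.
  (* l = 4 delta minimizes the exponent N l^2 / 8 - l N delta. *)
  have l0 : 0 <= 4 * delta by rewrite mulr_ge0// ltW.
  apply: le_trans (iid_law_cells _ _ _ P K N C (~` E) (N%:R * delta) _
    D_meas D_null (measurableC mE) l0 _) _; last first.
    (* With [2 ^+ K] and [beta] written as exponentials, the claim becomes K ln 2 - 2 N delta^2 <=
       ln beta, which is [Nd]. *)
    rewrite lee_fin -[2 ^+ K]lnK ?posrE ?exprn_gt0// -expRD -[leRHS]lnK ?posrE//.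
    rewrite ler_expR lnXn//.
    move: Nd; rewrite div1r lnV ?posrE// -[ln 2 *+ K]mulr_natl.
    have -> : N%:R * ((4 * delta) ^+ 2 / 8) - 4 * delta * (N%:R * delta) =
      - (N%:R * (2 * delta ^+ 2)) by field.
    lra.
  move=> s /existsNP[x /not_implyP[[Xx PPx] nCPx]].
  (* The cells on which a single [g h] certifies the offending [x]. *)
  pose S := [set j : 'I_K | `[< exists h, forall t, D j t -> g h (x, t) <= 0 >]]%SET.
  (* By contradiction: a count below N (P cov + delta) would force P cov > 1 - eps, hence
     CP-feasibility of [x]. *)
  exists S; rewrite leNgt; apply/negP => Scount; apply: nCPx; split=> //=.
  have mneg h : measurable [set t : borel (subspace_of hTheta) | g h (x, to_ambient t) <= 0].
    by apply: measurable_section_le0 (g_meas h).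
  set cov := \bigcup_(j in _) _ in Scount.
  have mcov : measurable cov.
    by apply: fin_bigcup_measurable => [|j _]; [exact: finite_finset|exact: D_meas].
  have PPS : N%:R * (1 - (eps - delta)) <=
      \sum_(j in S) #|[set i | `[< C j (tnth s i) >]]%SET|%:R.
    rewrite mulrC -ler_pdivlMr// mulr_suml; apply: le_trans PPx _.
    rewrite [leRHS]big_mkcond; apply: ler_sum => j _; rewrite finset.inE.
    by case: asboolP => _; rewrite ?mulr1 ?mulr0.
  apply: (@le_trans _ _ (P cov)).
    rewrite -[P cov]fineK ?fin_num_measure// lee_fin.
    rewrite -(ler_pM2l N0).
    have : N%:R * (1 - (eps - delta)) = N%:R * (1 - eps) + N%:R * delta by ring.
    lra.
  have -> : [set t | min_constraint hZ g (x, to_ambient t) <= 0] =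
      \bigcup_(h in [set: 'I_Z]) [set t : borel (subspace_of hTheta) | g h (x, to_ambient t) <= 0].
    apply/seteqP; split=> t /=.
      (* The default value of the minimum is the constraint of index [Ordinal hZ], so it too yields
         a witness. *)
      by case/bigmin_leP => [?|[h _ ?]]; [exists (Ordinal hZ)|exists h].
    by case=> h _ ?; apply/bigmin_leP; right; exists h.
  apply: le_measure; rewrite ?inE//.
    by apply: fin_bigcup_measurable => //; exact: finite_finset.
  move=> t [j /=]; rewrite finset.inE => /asboolP[h hj] Cj.
  by exists h => //; exact: hj.
rewrite -[E]setCK probability_setC; last exact: measurableC.
by rewrite EFinB leeB.
Qed.
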